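(* Let $X$ be a compact, connected, oriented Riemannian surface and $F$ an $SO(2)$ vector bundle of rank $2$ over $X$. Let $\sigma:T^*X\to S^2F$ be a symbol and let $\sigma_0$ be its traceless part. If $\sigma_0|_{S(T^*X)}:S(T^*X)\to S^2_0F$ is transversal to the zero section of $S^2_0F$, then $$\mathcal M_\sigma=\mathrm{sing}(\lambda_{\sigma,1}|_{S(T^*X)})=\mathrm{sing}(\lambda_{\sigma,2}|_{S(T^*X)}),$$ where for a function $f:S(T^*X)\to\mathbb R$ one defines $\mathrm{sing}(f)=\{\xi\in S(T^*X)\mid f\text{ is non-smooth at }\xi\}$.
   Context: $F$ is a real rank 2 vector bundle with a fibre metric and an orientation. $S^2F$ is the bundle of endomorphisms of the fibres of $F$ that are symmetric for the metric of $F$, and $S^2_0F\subset S^2F$ is the subbundle of traceless elements. A symbol is a smooth real vector bundle morphism $\sigma:T^*X\to S^2F$ (linear on each fibre); its traceless part is $\sigma_0=\sigma-\frac12\mathrm{tr}(\sigma)I$. $\lambda_{\sigma,1}(\xi)\le\lambda_{\sigma,2}(\xi)$ are the eigenvalues of $\sigma(\xi)$, and $S(T^*X)$ is the unit cosphere bundle for the metric induced on $T^*X$. The multiplicity set is $\mathcal M_\sigma=\{\xi\in S(T^*X)\mid\lambda_{\sigma,1}(\xi)=\lambda_{\sigma,2}(\xi)\}$. *)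

(* Defs.v *)
From HB Require Import structures.
From mathcomp Require Import all_boot all_order all_algebra.
From mathcomp Require Import all_classical all_reals all_analysis.

Set Implicit Arguments.
Unset Strict Implicit.
Unset Printing Implicit Defensive.

Import Order.TTheory GRing.Theory Num.Theory.
Import numFieldNormedType.Exports.

Local Open Scope classical_set_scope.
Local Open Scope ring_scope.

(* [Ck k U f]: f is of class C^k on the open set U. Intended for open U in
   finite-dimensional spaces V, where it is the usual notion. *)
Fixpoint Ck (R : realType) (V W : normedModType R) (k : nat) (U : set V)
    (f : V -> W) : Prop :=
  if k is k'.+1 then
    (forall x, U x -> differentiable f x) /\
    (forall v : V, Ck k' U (fun x => 'D_v f x))
  else forall x, U x -> {for x, continuous f}.

Definition Cinfty (R : realType) (V W : normedModType R) (U : set V)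
  (f : V -> W) : Prop := forall k, Ck k U f.

(* A family of coordinate maps on T with values in the model space V.
   [chart_map i] is meaningful only on [chart_dom i]. *)
Record charts (R : realType) (T : Type) (V : normedModType R) := Charts {
  chart_idx : Type;
  chart_dom : chart_idx -> set T;
  chart_map : chart_idx -> T -> V }.
Arguments chart_dom {R T V} c i _.
Arguments chart_map {R T V} c i _.

(* Smoothness near x of the restriction to A of a function, where A is an
   embedded submanifold of T (or an open subset): read in the charts around x,
   the restriction extends to a C^infty function on an open set of the model. *)
Definition smooth_at (R : realType) (T : Type) (V W : normedModType R)
    (C : charts T V) (A : set T) (f : T -> W) (x : T) : Prop :=
  forall i, chart_dom C i x ->
  exists (U : set V) (g : V -> W),
    [/\ open U, U (chart_map C i x), Cinfty U g &
        forall y, A y -> chart_dom C i y -> U (chart_map C i y) ->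
          f y = g (chart_map C i y)].

Definition smooth_map (R : realType) (T T' : Type) (V V' : normedModType R)
    (C : charts T V) (C' : charts T' V') (f : T -> T') : Prop :=
  forall x i j, chart_dom C i x -> chart_dom C' j (f x) ->
  exists (U : set V) (g : V -> V'),
    [/\ open U, U (chart_map C i x), Cinfty U g &
        forall y, chart_dom C i y -> U (chart_map C i y) ->
          chart_dom C' j (f y) /\ chart_map C' j (f y) = g (chart_map C i y)].

Definition sing (R : realType) (T : Type) (V : normedModType R)
    (C : charts T V) (A : set T) (f : T -> R) : set T :=
  [set x | A x /\ ~ smooth_at C A f x].

Definition smooth_curve_in (R : realType) (T : Type) (V : normedModType R)
    (C : charts T V) (A : set T) (x : T) (c : R -> T) : Prop :=
  [/\ c 0 = x,
      (exists U : set R, [/\ open U, U 0 & forall t, U t -> A (c t)]) &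
      forall i, chart_dom C i x ->
        exists U : set R,
          [/\ open U, U 0, (forall t, U t -> chart_dom C i (c t)) &
              Cinfty U (chart_map C i \o c)]].

Definition velocity (R : realType) (T : Type) (V : normedModType R)
    (C : charts T V) (i : chart_idx C) (c : R -> T) : V :=
  derive1 (chart_map C i \o c) 0.

(* For embedded submanifolds A of T and Z of N (N itself embedded in T'), the
   smooth map f : A -> N is transversal to Z:
     df (T_x A) + T_(f x) Z = T_(f x) N   whenever f x lies in Z.
   Tangent vectors are velocities of smooth curves, and df sends the velocity
   of a to the velocity of f o a; the inclusion of the left-hand side in the
   right-hand side is automatic, so only the other one is stated. *)
Definition transversal_map (R : realType) (T T' : Type) (V V' : normedModType R)
    (C : charts T V) (A : set T) (C' : charts T' V') (N Z : set T')
    (f : T -> T') : Prop :=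
  forall x, A x -> Z (f x) -> forall j, chart_dom C' j (f x) ->
  forall c, smooth_curve_in C' N (f x) c ->
  exists a b,
    [/\ smooth_curve_in C A x a, smooth_curve_in C' Z (f x) b &
        velocity j c = velocity j (f \o a) + velocity j b].

(* Second countability is not imposed here; it is automatic for compact X. *)
Record manifold (R : realType) (n : nat) (X : topologicalType) := Manifold {
  atlas :> charts X 'rV[R]_n;
  chart_inv : chart_idx atlas -> 'rV[R]_n -> X;
  chart_at : X -> chart_idx atlas;
  mem_chart_at : forall x, chart_dom atlas (chart_at x) x;
  chart_dom_open : forall i, open (chart_dom atlas i);
  chart_codom_open : forall i, open (chart_map atlas i @` chart_dom atlas i);
  chart_invK : forall i x, chart_dom atlas i x ->
    chart_inv i (chart_map atlas i x) = x;
  chart_map_continuous : forall i x, chart_dom atlas i x ->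
    {for x, continuous (chart_map atlas i)};
  chart_inv_continuous : forall i u,
    (chart_map atlas i @` chart_dom atlas i) u ->
    {for u, continuous (chart_inv i)};
  transition_smooth : forall i j,
    Cinfty (chart_map atlas i @` (chart_dom atlas i `&` chart_dom atlas j))
      (chart_map atlas j \o chart_inv i);
  manifold_hausdorff : hausdorff_space X }.

Definition transition (R : realType) (n : nat) (X : topologicalType)
    (M : manifold R n X) (i j : chart_idx M) : 'rV[R]_n -> 'rV[R]_n :=
  chart_map M j \o chart_inv i.

(* An oriented manifold is one whose given atlas is oriented. *)
Definition oriented_manifold (R : realType) (n : nat) (X : topologicalType)
    (M : manifold R n X) : Prop :=
  forall (i j : chart_idx M) x, chart_dom M i x -> chart_dom M j x ->
    0 < \det (jacobian (transition i j) (chart_map M i x)).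

Definition is_inner_product (R : realType) (V : lmodType R) (b : V -> V -> R) :
    Prop :=
  [/\ forall u v, b u v = b v u,
      forall a u v w, b (a *: u + v) w = a * b u w + b v w &
      forall v, v != 0 -> 0 < b v v].

Definition gram (R : realType) (V : lmodType R) (r : nat) (b : V -> V -> R)
    (e : 'I_r -> V) : 'M[R]_r := \matrix_(i, j) b (e i) (e j).

(* T_x X is 'rV_n: the coordinates of tangent vectors at x in the preferred
   chart [chart_at x]. The rows of [coord_frame i x] are the coordinate vectors
   d/du_1, ..., d/du_n at x of the chart i, seen in T_x X. *)
Definition coord_frame (R : realType) (n : nat) (X : topologicalType)
    (M : manifold R n X) (i : chart_idx M) (x : X) : 'M[R]_n :=
  jacobian (transition i (chart_at M x)) (chart_map M i x).

Record riemannian_metric (R : realType) (n : nat) (X : topologicalType)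
    (M : manifold R n X) := RiemannianMetric {
  tangent_metric :> X -> 'rV[R]_n -> 'rV[R]_n -> R;
  tangent_metric_inner : forall x, is_inner_product (tangent_metric x);
  tangent_metric_smooth : forall i x, chart_dom M i x ->
    smooth_at M (chart_dom M i)
      (fun y => gram (tangent_metric y) (fun a => row a (coord_frame i y))) x }.

(* T*_x X is 'cV_n, the dual of T_x X = 'rV_n for the pairing v *m p. The total
   space T*X is X * 'cV_n as a set only; its smooth structure is given by the
   usual charts (x, p) |-> (u(x), (p(d/du_a))_a), not by the product. *)
Definition cotangent (R : realType) (n : nat) (X : topologicalType)
    (M : manifold R n X) : Type := (X * 'cV[R]_n)%type.

Definition cotangent_charts (R : realType) (n : nat) (X : topologicalType)
    (M : manifold R n X) : charts (cotangent M) ('rV[R]_n * 'cV[R]_n)%type :=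
  @Charts R (cotangent M) ('rV[R]_n * 'cV[R]_n)%type (chart_idx M)
    (fun i xi => chart_dom M i xi.1)
    (fun i xi => (chart_map M i xi.1, coord_frame i xi.1 *m xi.2)).

(* The dual metric on T*_x X has the inverse Gram matrix in the dual basis. *)
Definition cometric_sqnorm (R : realType) (n : nat) (X : topologicalType)
    (M : manifold R n X) (g : riemannian_metric M) (xi : cotangent M) : R :=
  (xi.2^T *m invmx (gram (g xi.1) (fun a => delta_mx 0 a)) *m xi.2) 0 0.

Definition unit_cosphere (R : realType) (n : nat) (X : topologicalType)
    (M : manifold R n X) (g : riemannian_metric M) : set (cotangent M) :=
  [set xi | cometric_sqnorm g xi = 1].

(* Smooth real vector bundles of rank r, given by local frames. *)
Record vbundle (R : realType) (n : nat) (X : topologicalType)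
    (M : manifold R n X) (r : nat) := VBundle {
  fib : X -> vectType R;
  frame_idx : Type;
  frame_dom : frame_idx -> set X;
  frame : frame_idx -> forall x, r.-tuple (fib x);
  frame_dom_open : forall k, open (frame_dom k);
  frame_cover : forall x, exists k, frame_dom k x;
  frame_basis : forall k x, frame_dom k x -> basis_of fullv (frame k x);
  frame_smooth : forall k l x, frame_dom k x -> frame_dom l x ->
    smooth_at M (frame_dom k `&` frame_dom l)
      (fun y => \matrix_(a, b) coord (frame k y) b (tnth (frame l y) a)) x }.

(* An oriented bundle is one whose given local frames are consistently
   oriented. *)
Definition oriented_vbundle (R : realType) (n : nat) (X : topologicalType)
    (M : manifold R n X) (r : nat) (F : vbundle M r) : Prop :=
  forall (k l : frame_idx F) x, frame_dom k x -> frame_dom l x ->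
    0 < \det (\matrix_(a, b) coord (frame k x) b (tnth (frame l x) a)).

Record fibre_metric (R : realType) (n : nat) (X : topologicalType)
    (M : manifold R n X) (r : nat) (F : vbundle M r) := FibreMetric {
  fib_metric :> forall x, fib F x -> fib F x -> R;
  fib_metric_inner : forall x, is_inner_product (@fib_metric x);
  fib_metric_smooth : forall (k : frame_idx F) x, frame_dom k x ->
    smooth_at M (frame_dom k)
      (fun y => gram (@fib_metric y) (tnth (frame k y))) x }.

(* Total space of the endomorphism bundle of F. *)
Definition endo (R : realType) (n : nat) (X : topologicalType)
    (M : manifold R n X) (r : nat) (F : vbundle M r) : Type :=
  {x : X & 'End(fib F x)}.

Definition endo_at (R : realType) (n : nat) (X : topologicalType)
    (M : manifold R n X) (r : nat) (F : vbundle M r) (e : endo F) :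
    'End(fib F (tag e)) := tagged e.

(* Charts (x, A) |-> (coordinates of x, matrix of A in a local frame); row a of
   the matrix contains the components of the image of the a-th frame vector. *)
Definition endo_charts (R : realType) (n : nat) (X : topologicalType)
    (M : manifold R n X) (r : nat) (F : vbundle M r) :
    charts (endo F) ('rV[R]_n * 'M[R]_r)%type :=
  @Charts R (endo F) ('rV[R]_n * 'M[R]_r)%type
    (chart_idx M * frame_idx F)%type
    (fun ik e => chart_dom M ik.1 (tag e) /\ frame_dom ik.2 (tag e))
    (fun ik e => (chart_map M ik.1 (tag e),
       \matrix_(a, b) coord (frame ik.2 (tag e)) b
                        (endo_at e (tnth (frame ik.2 (tag e)) a)))).

Definition lfun_trace (R : realType) (V : vectType R) (A : 'End(V)) : R :=
  \tr (passmx.mxof (vbasis {:V}) (vbasis {:V}) A).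

(* S^2F and S^2_0F as subsets of the endomorphism bundle. *)
Definition sym_endo (R : realType) (n : nat) (X : topologicalType)
    (M : manifold R n X) (r : nat) (F : vbundle M r) (h : fibre_metric F) :
    set (endo F) :=
  [set e | forall u v, h (tag e) (endo_at e u) v = h (tag e) u (endo_at e v)].

Definition sym0_endo (R : realType) (n : nat) (X : topologicalType)
    (M : manifold R n X) (r : nat) (F : vbundle M r) (h : fibre_metric F) :
    set (endo F) :=
  [set e | sym_endo h e /\ lfun_trace (endo_at e) = 0].

Definition zero_section (R : realType) (n : nat) (X : topologicalType)
    (M : manifold R n X) (r : nat) (F : vbundle M r) : set (endo F) :=
  [set e | endo_at e = 0].
Arguments zero_section {R n X M r} F _.

Record symbol (R : realType) (n : nat) (X : topologicalType)
    (M : manifold R n X) (r : nat) (F : vbundle M r) (h : fibre_metric F) :=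
  Symbol {
  symb :> forall x, {linear 'cV[R]_n -> 'End(fib F x)};
  symb_sym : forall x p, sym_endo h (Tagged (fun x => 'End(fib F x)) (symb x p));
  symb_smooth : smooth_map (cotangent_charts M) (endo_charts F)
    (fun xi => Tagged (fun x => 'End(fib F x)) (symb xi.1 xi.2)) }.

Definition traceless_part (R : realType) (n : nat) (X : topologicalType)
    (M : manifold R n X) (F : vbundle M 2) (h : fibre_metric F)
    (sigma : symbol h) (xi : cotangent M) : endo F :=
  Tagged (fun x => 'End(fib F x))
    (sigma xi.1 xi.2 - (2^-1 * lfun_trace (sigma xi.1 xi.2)) *: \1%VF).

(* F has rank 2, so the ordered eigenvalues (with multiplicity) of sigma(xi)
   are the least and the greatest element of its finite spectrum. *)
Definition lambda1 (R : realType) (n : nat) (X : topologicalType)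
    (M : manifold R n X) (F : vbundle M 2) (h : fibre_metric F)
    (sigma : symbol h) (xi : cotangent M) : R :=
  inf [set a | passmx.leigenvalue (sigma xi.1 xi.2) a].

Definition lambda2 (R : realType) (n : nat) (X : topologicalType)
    (M : manifold R n X) (F : vbundle M 2) (h : fibre_metric F)
    (sigma : symbol h) (xi : cotangent M) : R :=
  sup [set a | passmx.leigenvalue (sigma xi.1 xi.2) a].

Definition multiplicity_set (R : realType) (n : nat) (X : topologicalType)
    (M : manifold R n X) (F : vbundle M 2) (h : fibre_metric F)
    (sigma : symbol h) (g : riemannian_metric M) : set (cotangent M) :=
  [set xi | unit_cosphere g xi /\ lambda1 sigma xi = lambda2 sigma xi].

(* Main.v *)
From HB Require Import structures.
Require Import Defs.
From mathcomp Require Import all_boot all_order all_algebra.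
From mathcomp Require Import all_classical all_reals all_analysis.
From mathcomp Require Import ring lra.

Set Implicit Arguments.
Unset Strict Implicit.
Unset Printing Implicit Defensive.

Import Order.TTheory GRing.Theory Num.Theory.
Import numFieldNormedType.Exports.

Local Open Scope classical_set_scope.
Local Open Scope ring_scope.

(* Near a point of T*X, in local frames, lambda_1 and lambda_2 are
   (tr m -/+ sqrt (disc m)) / 2 with m the smooth matrix of sigma and disc m =
   (tr m)^2 - 4 det m; since sigma is symmetric, disc m >= 0 with equality
   exactly where sigma_0 vanishes. Off the multiplicity set this is smooth.
   At a multiple point, apply transversality to one fibre direction B <> 0 of
   S^2_0 F: some curve in S(T*X) has sigma_0 o a = t B + o(t), so that
   disc = t^2 disc B + o(t^2) along it with disc B > 0. Were one eigenvalue
   smooth, sqrt disc would be differentiable along the curve, with derivative 0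
   at its minimum 0, and yet with derivative squared equal to disc B. *)

(** * Functions of class C^k *)

(** The first-order expansion of [f] at [x] is also one of [g], since both have the same germ;
    uniqueness of the differential then identifies ['d g x] with ['d f x]. *)
Lemma near_eq_differentiable (R : realType) (V W : normedModType R)
    (f g : V -> W) (x : V) :
  (\near x, f x = g x) -> differentiable f x -> differentiable g x.
Proof.
move=> fg df; have fgx : f x = g x by exact: nbhs_singleton fg.
have cdf : continuous ('d f x) by exact: diff_continuous.
have gE : g \o shift x = cst (g x) + 'd f x +o_ 0 id.
  apply/eqaddoP => _/posnumP[e].
  have /eqaddoP/(_ e%:num (gt0 e)) fe := diff_locally df.
  have fg0 : \forall h \near 0, f (h + x) = g (h + x).
    by move: fg; rewrite (near_shift 0) subr0.
  apply: filterS2 fe fg0 => h /=.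
  by rewrite !fctE /= fgx => + fgh; rewrite -fgh.
have dgE := diff_unique cdf gE.
by apply/diff_locallyP; rewrite dgE.
Qed.

Section Ck_theory.
Variables (R : realType) (V : normedModType R).

(** Openness of [U] turns equality on [U] into equality of germs at its points, so the directional
    derivatives agree on [U] too. This is what lets differentiation rules valid only on [U] feed the
    inductions below. *)
Lemma eq_Ck (W : normedModType R) k (U : set V) (f g : V -> W) :
  open U -> (forall x, U x -> f x = g x) -> Ck k U f -> Ck k U g.
Proof.
move=> oU; elim: k f g => [|k IH] f g fg /=.
  move=> Cf x Ux; have nfg : \near x, f x = g x.
    by apply: filterS (open_nbhs_nbhs (conj oU Ux)) => y /fg.
  rewrite /prop_for /continuous_at -(fg x Ux).
  apply: cvg_trans (Cf x Ux); apply: near_eq_cvg.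
  exact: nfg.
move=> [df Df]; split=> [x Ux|v].
  have nfg : \near x, f x = g x.
    by apply: filterS (open_nbhs_nbhs (conj oU Ux)) => y /fg.
  exact: near_eq_differentiable nfg (df x Ux).
apply: IH (Df v) => x Ux; apply: near_eq_derive.
by apply: filterS (open_nbhs_nbhs (conj oU Ux)) => y /fg.
Qed.

Lemma Ck_subset (W : normedModType R) k (U U' : set V) (f : V -> W) :
  U' `<=` U -> Ck k U f -> Ck k U' f.
Proof.
move=> UU; elim: k f => [|k IH] f /=; first by move=> Cf x /UU /Cf.
by move=> [df Df]; split=> [x /UU /df//|v]; exact: IH.
Qed.

Lemma CkW (W : normedModType R) k (U : set V) (f : V -> W) :
  Ck k.+1 U f -> Ck k U f.
Proof.
elim: k f => [|k IH] f [df Df].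
  by move=> x Ux; exact: differentiable_continuous (df x Ux).
by split=> // v; exact: IH.
Qed.

Lemma Ck_cst (W : normedModType R) k (U : set V) (c : W) :
  Ck k U (fun=> c).
Proof.
elim: k c => [|k IH] c /=; first by move=> x _; exact: cvg_cst.
split=> [x _|v]; first exact: differentiable_cst.
have -> : (fun x => 'D_v (fun=> c) x) = fun=> 0 :> W.
  by apply/funext => x; exact: derive_cst.
exact: IH.
Qed.

Lemma CkD (W : normedModType R) k (U : set V) (f g : V -> W) : open U ->
  Ck k U f -> Ck k U g -> Ck k U (fun x => f x + g x).
Proof.
move=> oU; elim: k f g => [|k IH] f g /=.
  by move=> Cf Cg x Ux; apply: cvgD; [exact: Cf|exact: Cg].
move=> [df Df] [dg Dg]; split=> [x Ux|v].
  by apply: differentiableD; [exact: df|exact: dg].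
apply: eq_Ck (IH _ _ (Df v) (Dg v)) => // x Ux.
by rewrite deriveD//; apply: diff_derivable; [exact: df|exact: dg].
Qed.

Lemma CkM k (U : set V) (f g : V -> R) : open U ->
  Ck k U f -> Ck k U g -> Ck k U (fun x => f x * g x).
Proof.
move=> oU; elim: k f g => [|k IH] f g Cf Cg /=.
  by move=> x Ux; apply: cvgM; [exact: Cf|exact: Cg].
move: (Cf) (Cg) => [df Df] [dg Dg]; split=> [x Ux|v].
  by apply: differentiableM; [exact: df|exact: dg].
(* The Leibniz rule keeps one undifferentiated factor in each term; [CkW] lowers its class to that
   of the derivative. *)
have CD := CkD oU (IH _ _ (CkW Cf) (Dg v)) (IH _ _ (CkW Cg) (Df v)).
apply: eq_Ck CD => // x Ux.
by rewrite deriveM//; apply: diff_derivable; [exact: df|exact: dg].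
Qed.

(** A continuous linear map is its own differential, hence commutes with ['D_v], and the induction
    only changes [f]. *)
Lemma Ck_linear_comp (W W' : normedModType R) (L : {linear W -> W'}) k
    (U : set V) (f : V -> W) :
  open U -> continuous L -> Ck k U f -> Ck k U (fun x => L (f x)).
Proof.
move=> oU cL; elim: k f => [|k IH] f /=.
  by move=> Cf x Ux; apply: (continuous_comp (Cf x Ux)); exact: cL.
move=> [df Df]; split=> [x Ux|v].
  apply: differentiable_comp (df x Ux) _.
  exact: linear_differentiable.
apply: eq_Ck (IH _ (Df v)) => // x Ux.
have dL : differentiable L (f x) by exact: linear_differentiable.
rewrite (deriveE _ (df x Ux)) [RHS]deriveE; last first.
  exact: differentiable_comp (df x Ux) dL.
by rewrite (diff_comp (df x Ux) dL) /= diff_lin.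
Qed.

(* With s = sqrt d one has s' = d' / (2 s) and (1/s)' = - d' / (2 s^3), which
   makes the induction on k close on the pair (s, 1/s). *)
Lemma Ck_sqrt k (U : set V) (d : V -> R) : open U ->
  (forall x, U x -> 0 < d x) -> Ck k U d ->
  Ck k U (fun x => Num.sqrt (d x)) /\ Ck k U (fun x => (Num.sqrt (d x))^-1).
Proof.
move=> oU d0; elim: k => [|k IH] Cd.
  have Cs x : U x -> {for x, continuous (fun x => Num.sqrt (d x))}.
    by move=> Ux; apply: (continuous_comp (Cd x Ux)); exact: sqrt_continuous.
  split=> // x Ux.
  apply: (@cvgV _ _ _ _ (fun x => Num.sqrt (d x))); last exact: Cs.
  by rewrite gt_eqF ?sqrtr_gt0 ?d0.
have [Cs Cw] := IH (CkW Cd); have [dd Dd] := Cd.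
have ds x : U x -> differentiable (@Num.sqrt R) (d x).
  move=> Ux; apply/derivable1_diffP; apply: ex_derive.
  by apply: is_derive1_sqrt; exact: d0.
have sD x v : U x -> is_derive x v (fun x => Num.sqrt (d x))
     (2^-1 * ((Num.sqrt (d x))^-1 * 'D_v d x)).
  move=> Ux; have dsx := ds x Ux.
  apply: DeriveDef.
    by apply: diff_derivable; exact: differentiable_comp (dd x Ux) dsx.
  rewrite deriveE; last exact: differentiable_comp (dd x Ux) dsx.
  rewrite (diff_comp (dd x Ux) dsx) /= diff1E// -deriveE; last exact: dd.
  have /@derive_val := is_derive1_sqrt (d0 x Ux); rewrite -derive1E => ->.
  by rewrite /GRing.scale/= invfM; ring.
have sd x : U x -> differentiable (fun x => Num.sqrt (d x)) x.
  by move=> Ux; exact: differentiable_comp (dd x Ux) (ds x Ux).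
have s0 x : U x -> Num.sqrt (d x) != 0.
  by move=> Ux; rewrite gt_eqF ?sqrtr_gt0 ?d0.
split; split=> [x Ux|v]; first exact: sd.
- apply: eq_Ck (CkM oU (Ck_cst k U (2^-1 : R)) (CkM oU Cw (Dd v))) => // x Ux.
  by have /@derive_val -> := sD x v Ux.
- by apply: differentiableV; [exact: sd|exact: s0].
have Cw3 := CkM oU Cw (CkM oU Cw Cw).
apply: eq_Ck (CkM oU (Ck_cst k U (- 2^-1 : R)) (CkM oU Cw3 (Dd v))) => // x Ux.
rewrite deriveV ?s0//; last exact: diff_derivable (sd x Ux).
have /@derive_val -> := sD x v Ux.
rewrite /GRing.scale/=; field.
exact: s0.
Qed.

End Ck_theory.

(** * Symmetric endomorphisms of a plane *)

Section bilinear_form.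
Variables (R : realType) (V : lmodType R) (b : V -> V -> R).
Hypothesis b_inner : is_inner_product b.

Lemma inner_product_linearl a u v w : b (a *: u + v) w = a * b u w + b v w.
Proof. by have [_ ->] := b_inner. Qed.

Lemma inner_productDl u v w : b (u + v) w = b u w + b v w.
Proof. by rewrite -[u]scale1r inner_product_linearl scale1r mul1r. Qed.

Lemma inner_product0l w : b 0 w = 0.
Proof. by apply: (addrI (b 0 w)); rewrite -inner_productDl !addr0. Qed.

Lemma inner_productZl a u w : b (a *: u) w = a * b u w.
Proof.
by rewrite -[a *: u]addr0 inner_product_linearl inner_product0l addr0.
Qed.

Lemma inner_productC u v : b u v = b v u.
Proof. by have [->] := b_inner. Qed.

Lemma inner_product_ge0 u : 0 <= b u u.
Proof.
have [-> | u0] := eqVneq u 0; first by rewrite inner_product0l.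
by have [_ _ b_gt0] := b_inner; exact/ltW/b_gt0.
Qed.

Lemma inner_product_eq0 u : b u u = 0 -> u = 0.
Proof.
move=> bu0; apply/eqP; apply: contraT => u0.
by have [_ _ /(_ u u0)] := b_inner; rewrite bu0 ltxx.
Qed.

End bilinear_form.

(** The row convention is that of [endo_charts], so this is the matrix component of a bundle
    chart. *)
Definition frame_mx (R : realType) (V : vectType R) (r : nat) (e : r.-tuple V)
    (A : 'End(V)) : 'M[R]_r :=
  \matrix_(a, b) coord e b (A (tnth e a)).

Section frame_matrix.
Variables (R : realType) (V : vectType R) (r : nat) (e : r.-tuple V).
Hypothesis e_basis : basis_of fullv e.

Lemma basis_neq0 i : tnth e i != 0.
Proof. exact: free_not0 (basis_free e_basis) (mem_tnth i e). Qed.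

Lemma frame_mx_linear : linear (frame_mx e).
Proof.
move=> a A B; apply/matrixP => i j.
by rewrite !mxE add_lfunE scale_lfunE linearP.
Qed.

Lemma frame_mx1 : frame_mx e \1 = 1%:M.
Proof.
apply/matrixP => i j; rewrite !mxE id_lfunE (tnth_nth 0).
by rewrite coord_free ?(basis_free e_basis)// eq_sym.
Qed.

Lemma frame_mx_row (A : 'End(V)) i :
  A (tnth e i) = \sum_j frame_mx e A i j *: tnth e j.
Proof.
rewrite [LHS](coord_basis e_basis (memvf _)); apply: eq_bigr => j _.
by rewrite mxE !(tnth_nth 0).
Qed.

Lemma frame_mx_eq0 (A : 'End(V)) : frame_mx e A = 0 -> A = 0.
Proof.
move=> mA0; apply/lfunP => v; rewrite zero_lfunE.
rewrite [v](coord_basis e_basis (memvf _)) linear_sum big1// => i _.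
rewrite linearZ/= -(tnth_nth 0) frame_mx_row mA0 big1 ?scaler0// => j _.
by rewrite mxE scale0r.
Qed.

End frame_matrix.

(** Gives access to the theory of [passmx], whose bases have length [\dim {:V}]; a general [r] is
    first identified with that dimension. *)
Lemma frame_mx_mxof (R : realType) (V : vectType R) (e : (\dim {:V}).-tuple V)
  (A : 'End(V)) : frame_mx e A = passmx.mxof e e A.
Proof.
apply/matrixP => i j.
by rewrite !mxE /= passmx.vecof_delta (tnth_nth 0).
Qed.

(** Change of basis: the matrix in [vbasis] is a transition matrix times the mixed matrix of [A],
    and cyclicity of the trace recombines the two factors into the matrix in [e]. *)
Lemma lfun_trace_frame (R : realType) (V : vectType R) (r : nat)
    (e : r.-tuple V) (A : 'End(V)) :
  basis_of fullv e -> lfun_trace A = \tr (frame_mx e A).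
Proof.
move=> eb; have E : r = \dim {:V} by rewrite -(size_basis eb).
subst r; rewrite frame_mx_mxof /lfun_trace.
have vb := vbasisP {:V}.
have -> : passmx.mxof (vbasis {:V}) (vbasis {:V}) A =
    passmx.mxof (vbasis {:V}) e \1 *m passmx.mxof e (vbasis {:V}) A.
  by rewrite -passmx.mxof_comp// comp_lfun1r.
rewrite mxtrace_mulC -passmx.mxof_comp//.
by rewrite comp_lfun1l.
Qed.

Lemma leigenvalue_frame (R : realType) (V : vectType R) (r : nat)
    (e : r.-tuple V) (A : 'End(V)) (a : R) :
  basis_of fullv e -> passmx.leigenvalue A a = eigenvalue (frame_mx e A) a.
Proof.
move=> eb; have E : r = \dim {:V} by rewrite -(size_basis eb).
subst r; rewrite frame_mx_mxof /passmx.leigenvalue.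
by rewrite (passmx.leigenspaceE eb) passmx.vsof_eq0.
Qed.

(** * Eigenvalues and discriminant of a 2 x 2 matrix *)

Section matrix22.
Variable R : realType.
Implicit Type m : 'M[R]_2.

(** The discriminant of the characteristic polynomial, in a form that shows it to be quadratic in
    [m] and unchanged when a scalar matrix is added. *)
Definition disc m : R := (m 0 0 - m 1 1) ^+ 2 + 4 * (m 0 1 * m 1 0).

Lemma mxtrace2 m : \tr m = m 0 0 + m 1 1.
Proof.
rewrite /mxtrace !big_ord_recl big_ord0 addr0.
by congr (_ + m _ _); apply/val_inj.
Qed.

Lemma det2 m : \det m = m 0 0 * m 1 1 - m 0 1 * m 1 0.
Proof.
rewrite (expand_det_row _ 0) !big_ord_recl big_ord0 /cofactor !det_mx11 !mxE/=.
rewrite (_ : lift 0 0 = 1 :> 'I_2); last exact/val_inj.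
rewrite (_ : lift 1 0 = 0 :> 'I_2); last exact/val_inj.
rewrite expr0 expr1; ring.
Qed.

Lemma eigenvalue2 m a :
  eigenvalue m a = ((a - m 0 0) * (a - m 1 1) == m 0 1 * m 1 0).
Proof.
have dE : \det (m - a%:M) = (a - m 0 0) * (a - m 1 1) - m 0 1 * m 1 0.
  by rewrite det2 !mxE/= !mulr1n !mulr0n !subr0; ring.
rewrite -subr_eq0 -dE; apply/eigenvalueP/det0P => [[v vm v0]|[v v0 /eqP]].
  by exists v => //; rewrite mulmxBr vm mul_mx_scalar subrr.
by rewrite mulmxBr mul_mx_scalar subr_eq0 => /eqP vm; exists v.
Qed.

(** Quadratic formula: once [disc m] is written as [s ^+ 2], the characteristic polynomial is the
    product of the two linear factors. *)
Lemma eigenvalue2_disc m a : 0 <= disc m ->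
  eigenvalue m a = (a == (\tr m - Num.sqrt (disc m)) / 2) ||
                   (a == (\tr m + Num.sqrt (disc m)) / 2).
Proof.
move=> d0; rewrite eigenvalue2 -subr_eq0 -[in RHS]subr_eq0.
rewrite -[X in _ || X]subr_eq0 -mulf_eq0; congr (_ == 0).
have := sqr_sqrtr d0; set s := Num.sqrt _ => hs.
transitivity (a ^+ 2 - a * \tr m + ((\tr m) ^+ 2 - s ^+ 2) / 4); last by field.
by rewrite hs /disc mxtrace2; field.
Qed.

End matrix22.

Lemma inf_set2 (R : realType) (x y : R) : x <= y -> inf [set x; y] = x.
Proof.
move=> xy; have lb : lbound [set x; y] x by move=> z [->|->].
apply/le_anti/andP; split.
  by apply: ge_inf; [exists x|left].
by apply: lb_le_inf => //; exists x; left.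
Qed.

Lemma sup_set2 (R : realType) (x y : R) : x <= y -> sup [set x; y] = y.
Proof.
move=> xy; have ub : ubound [set x; y] y by move=> z [->|->].
apply/le_anti/andP; split.
  by apply: ge_sup => //; exists y; right.
by apply: ub_le_sup; [exists y|right].
Qed.

Section symmetric_endomorphism.
Variables (R : realType) (V : vectType R) (b : V -> V -> R) (e : 2.-tuple V).
Hypothesis b_inner : is_inner_product b.
Hypothesis e_basis : basis_of fullv e.
Variable A : 'End(V).
Hypothesis A_sym : forall u v, b (A u) v = b u (A v).
Local Notation m := (frame_mx e A).
Local Notation e0 := (tnth e 0).
Local Notation e1 := (tnth e 1).

(** The frame need not be orthonormal, so self-adjointness of [A] does not make [m] symmetric.
    Testing it on the pair [e0], [e1] gives this relation, twisted by the Gram matrix. *)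
Lemma frame_gram_sym :
  m 0 1 * b e1 e1 + m 0 0 * b e0 e1 = m 1 0 * b e0 e0 + m 1 1 * b e0 e1.
Proof.
have := A_sym e0 e1; rewrite [b e0 _](inner_productC b_inner).
rewrite !(frame_mx_row e_basis) !big_ord_recl !big_ord0 !addr0.
rewrite (_ : lift ord0 ord0 = 1 :> 'I_2); last exact/val_inj.
rewrite !(inner_productDl b_inner) !(inner_productZl b_inner).
rewrite [b e1 e0](inner_productC b_inner) => <-; exact: addrC.
Qed.

(** This is [2 *: A e0 - \tr m *: e0], twice the traceless part of [A] applied to [e0]. *)
Let w := (m 0 0 - m 1 1) *: e0 + (2 * m 0 1) *: e1.

(** The traceless part of [A] is self-adjoint and, by Cayley-Hamilton, its square is [disc m / 4]
    times the identity; this is the conceptual reason. The proof expands both sides and eliminates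
    [m 1 0] by [frame_gram_sym]. *)
Lemma disc_inner : b e0 e0 * disc m = b w w.
Proof.
have E := frame_gram_sym.
rewrite /w !(inner_productDl b_inner) !(inner_productZl b_inner).
rewrite ![b e0 (_ + _)](inner_productC b_inner).
rewrite ![b e1 (_ + _)](inner_productC b_inner).
rewrite !(inner_productDl b_inner) !(inner_productZl b_inner).
rewrite [b e1 e0](inner_productC b_inner) /disc.
have {}E : m 1 0 * b e0 e0 =
    m 0 1 * b e1 e1 + m 0 0 * b e0 e1 - m 1 1 * b e0 e1.
  by rewrite E; ring.
transitivity ((m 0 0 - m 1 1) ^+ 2 * b e0 e0 + 4 * m 0 1 * (m 1 0 * b e0 e0)).
  by ring.
by rewrite E; ring.
Qed.

Lemma sym_disc_ge0 : 0 <= disc m.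
Proof.
have e00 : 0 < b e0 e0.
  by have [_ _ ->] := b_inner; rewrite ?(basis_neq0 e_basis).
by rewrite -(pmulr_rge0 _ e00) disc_inner inner_product_ge0.
Qed.

(** By [disc_inner] and definiteness [w] vanishes; freeness of the frame kills its two coefficients,
    and [frame_gram_sym] then kills [m 1 0]. *)
Lemma sym_disc_eq0 : disc m = 0 -> m = (2^-1 * \tr m)%:M.
Proof.
move=> d0; have e00 : b e0 e0 != 0.
  by rewrite gt_eqF//; have [_ _ ->] := b_inner; rewrite ?(basis_neq0 e_basis).
have w0 : w = 0.
  by apply: (inner_product_eq0 b_inner); rewrite -disc_inner d0 mulr0.
have [d00 m01] : m 0 0 - m 1 1 = 0 /\ 2 * m 0 1 = 0.
  have /freeP := basis_free e_basis.
  move=> /(_ (fun i => if i == 0 then m 0 0 - m 1 1 else 2 * m 0 1)).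
  rewrite !big_ord_recl big_ord0 addr0 -!tnth_nth /=.
  rewrite (_ : lift ord0 ord0 = 1 :> 'I_2); last exact/val_inj.
  by move=> /(_ w0) h; split; [exact: (h 0)|exact: (h 1)].
have {}m01 : m 0 1 = 0 by apply/eqP; move/eqP: m01; rewrite mulf_eq0 pnatr_eq0.
have m11 : m 0 0 = m 1 1 by apply/eqP; rewrite -subr_eq0 d00.
have m10 : m 1 0 = 0.
  have := frame_gram_sym; rewrite m01 m11 mul0r add0r => /eqP.
  rewrite -subr_eq0 opprD addrCA subrr addr0 oppr_eq0 mulf_eq0.
  by rewrite (negPf e00) orbF => /eqP.
apply/matrixP => i j; rewrite mxtrace2 [RHS]mxE.
have -> : 2^-1 * (m 0 0 + m 1 1) = m 0 0 by rewrite m11; field.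
case: i => [] [|[|//]] ?; case: j => [] [|[|//]] ? /=.
- rewrite mulr1n; congr (m _ _); exact/val_inj.
- rewrite mulr0n -[RHS]m01; congr (m _ _); exact/val_inj.
- rewrite mulr0n -[RHS]m10; congr (m _ _); exact/val_inj.
- rewrite mulr1n m11; congr (m _ _); exact/val_inj.
Qed.

Lemma leigenvalue_sym : [set a | passmx.leigenvalue A a] =
  [set (\tr m - Num.sqrt (disc m)) / 2; (\tr m + Num.sqrt (disc m)) / 2].
Proof.
apply/seteqP; split => a /=; rewrite (leigenvalue_frame _ _ e_basis).
  by rewrite (eigenvalue2_disc _ sym_disc_ge0) => /orP[/eqP|/eqP]; [left|right].
by rewrite (eigenvalue2_disc _ sym_disc_ge0) => -[->|->]; rewrite eqxx ?orbT.
Qed.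

Lemma sym_roots_le :
  (\tr m - Num.sqrt (disc m)) / 2 <= (\tr m + Num.sqrt (disc m)) / 2.
Proof. by have := sqrtr_ge0 (disc m); lra. Qed.

Lemma inf_leigenvalue : inf [set a | passmx.leigenvalue A a] =
  (\tr m - Num.sqrt (disc m)) / 2.
Proof. by rewrite leigenvalue_sym inf_set2// sym_roots_le. Qed.

Lemma sup_leigenvalue : sup [set a | passmx.leigenvalue A a] =
  (\tr m + Num.sqrt (disc m)) / 2.
Proof. by rewrite leigenvalue_sym sup_set2// sym_roots_le. Qed.

End symmetric_endomorphism.

Lemma lfun_traceZ (R : realType) (V : vectType R) (a : R) (A : 'End(V)) :
  lfun_trace (a *: A) = a * lfun_trace A.
Proof.
rewrite !(lfun_trace_frame _ (vbasisP {:V})) -mxtraceZ; congr (\tr _).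
by apply/matrixP => i j; rewrite !mxE scale_lfunE linearZ.
Qed.

(** The witness is [b v v / 2] times the reflection that fixes [v] and negates its orthogonal
    complement. Its eigenvalues differ by [b v v], so its discriminant is [b v v ^+ 2], and no
    orthonormal frame has to be built. *)
Lemma exists_traceless_sym (R : realType) (V : vectType R) (b : V -> V -> R)
    (e : 2.-tuple V) : is_inner_product b -> basis_of fullv e ->
  exists B : 'End(V), [/\ forall u v, b (B u) v = b u (B v), lfun_trace B = 0 &
    0 < disc (frame_mx e B)].
Proof.
move=> b_inner e_basis; set v := tnth e 0.
pose f u : V := b u v *: v - (b v v / 2) *: u.
have f_lin : linear f.
  move=> a x y; rewrite /f (inner_product_linearl b_inner).
  by rewrite scalerDl scalerDr scalerBr !scalerA opprD addrACA [_ / 2 * a]mulrC.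
pose fL : {linear V -> V} := HB.pack f (GRing.isLinear.Build R V V _ f f_lin).
have [B fE] : exists B : 'End(V), forall u, B u = f u.
  by exists (linfun fL) => u; rewrite lfunE.
have mE i j : frame_mx e B i j =
    b (tnth e i) v * (j == 0)%:R - b v v / 2 * (i == j)%:R.
  rewrite mxE fE /f linearB !linearZ/= /v !(tnth_nth 0).
  by rewrite !coord_free ?(basis_free e_basis)// [0 == j]eq_sym.
have vv : 0 < b v v by have [_ _ ->] := b_inner; rewrite ?(basis_neq0 e_basis).
exists B; split.
- move=> x y; rewrite !fE /f [RHS](inner_productC b_inner).
  rewrite -!scaleNr !(inner_productDl b_inner) !(inner_productZl b_inner).
  rewrite [b v y](inner_productC b_inner) [b v x](inner_productC b_inner).
  by rewrite [b y x](inner_productC b_inner) [b y v * _]mulrC.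
- by rewrite (lfun_trace_frame _ e_basis) mxtrace2 !mE /= -/v; field.
- rewrite /disc !mE /= -/v.
  by rewrite (_ : _ + _ = b v v ^+ 2) ?exprn_gt0//; field.
Qed.

(** * Square root of the discriminant along a curve of matrices *)

Section sqrt_disc.
Variables (R : realType) (P : R -> 'M[R]_2) (B : 'M[R]_2).

Lemma disc_scale (a : R) (m : 'M[R]_2) : disc (a *: m) = a ^+ 2 * disc m.
Proof. by rewrite /disc !mxE; ring. Qed.

Lemma sqrt_disc_not_derivable : P 0 = 0 ->
  (forall i j, is_derive (0 : R) (1 : R) (fun t => P t i j) (B i j)) ->
  (\forall t \near 0, 0 <= disc (P t)) -> 0 < disc B ->
  ~ derivable (fun t => Num.sqrt (disc (P t))) 0 1.
Proof.
move=> P0 dP dPge0 dB; set f := fun t => _.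
move=> df; set l := 'D_1 f 0.
have f0 : f 0 = 0.
  by rewrite /f P0 /disc !mxE !subrr mul0r mulr0 expr0n addr0 sqrtr0.
have cf : h^-1 * f h @[h --> 0^'] --> l.
  rewrite (_ : (fun h => _) =
    (fun h : R => h^-1 *: ((f \o shift 0) (h *: 1) - f 0))) //.
  by apply/funext => h; rewrite f0 subr0 /= addr0 [h *: 1]mulr1.
have cP i j : h^-1 * P h i j @[h --> 0^'] --> B i j.
  have [dPij <-] := dP i j.
  rewrite (_ : (fun h => _) = (fun h : R =>
    h^-1 *: (((fun t => P t i j) \o shift 0) (h *: 1) - P 0 i j))) //.
  by apply/funext => h; rewrite P0 mxE subr0 /= addr0 [h *: 1]mulr1.
(* Since [disc] is homogeneous of degree 2, the squared quotient of [f] is [disc] of the matrix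
   quotient [h^-1 *: P h], which tends to [B]. *)
have lB : l ^+ 2 = disc B.
  have c1 : (h^-1 * f h) ^+ 2 @[h --> 0^'] --> l ^+ 2 by apply: cvgM.
  have c2 : (h^-1 * f h) ^+ 2 @[h --> 0^'] --> disc B.
    have c3 : disc (h^-1 *: P h) @[h --> 0^'] --> disc B.
      rewrite /disc expr2; under eq_fun do rewrite !mxE expr2.
      apply: cvgD; [apply: cvgM; apply: cvgB; exact: cP|].
      by apply: cvgMr; apply: cvgM; exact: cP.
    apply: cvg_trans c3; apply: near_eq_cvg; near=> h.
    rewrite disc_scale exprMn sqr_sqrtr//.
    by near: h; exact: nbhs_dnbhs.
  exact: cvg_unique c1 c2.
(* As [f] is nonnegative and vanishes at 0, its quotients are nonpositive on the left of 0 and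
   nonnegative on the right. *)
have l0 : l = 0.
  apply/le_anti/andP; split.
    have cl : h^-1 * f h @[h --> 0^'-] --> l.
      move=> A /cf /nbhs_ballP [_ /posnumP[r] rA].
      by exists r%:num => //= y ry /lt_eqF/negbT/rA; exact.
    rewrite -(cvg_lim _ cl)//; apply: limr_le; first by apply/cvg_ex; exists l.
    near=> h; apply: mulr_le0_ge0; last exact: sqrtr_ge0.
    by rewrite invr_le0; apply: ltW; near: h; exact: nbhs_left_lt.
  have cl : h^-1 * f h @[h --> 0^'+] --> l.
    move=> A /cf /nbhs_ballP [_ /posnumP[r] rA].
    by exists r%:num => //= y ry /gt_eqF/negbT/rA; exact.
  rewrite -(cvg_lim _ cl)//; apply: limr_ge; first by apply/cvg_ex; exists l.
  near=> h; apply: mulr_ge0; last exact: sqrtr_ge0.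
  by rewrite invr_ge0; apply: ltW; near: h; exact: nbhs_right_gt.
by move: dB; rewrite -lB l0 expr0n ltxx.
Unshelve. all: by end_near. Qed.

End sqrt_disc.

(** * Smoothness in local frames *)

Section Ck_matrix.
Variables (R : realType) (V W : normedModType R) (r : nat).

(** Named so as to carry a linear structure: smoothness and velocities in bundle charts are then
    read entry by entry. *)
Definition snd_entry (i j : 'I_r) (w : W * 'M[R]_r) : R := w.2 i j.

Lemma snd_entry_linear i j : linear (snd_entry i j : _ -> R^o).
Proof. by move=> a u v; rewrite /snd_entry !mxE. Qed.

HB.instance Definition _ i j := GRing.isLinear.Build R (W * 'M[R]_r)%type R^o _
  (snd_entry i j) (snd_entry_linear i j).

Lemma snd_entry_continuous i j : continuous (snd_entry i j).
Proof.
move=> w; apply: (@continuous_comp _ _ _ snd (fun m : 'M[R]_r => m i j)).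
  exact: cvg_snd.
exact: coord_continuous.
Qed.

Lemma Ck_snd_entry k (U : set V) (G : V -> W * 'M[R]_r) i j :
  open U -> Ck k U G -> Ck k U (fun u => (G u).2 i j : R).
Proof.
move=> oU; apply: (@Ck_linear_comp _ _ _ R^o (snd_entry i j)) => //.
exact: snd_entry_continuous.
Qed.

End Ck_matrix.

Lemma CkB (R : realType) (V : normedModType R) k (U : set V) (f g : V -> R) :
  open U -> Ck k U f -> Ck k U g -> Ck k U (fun x => f x - g x).
Proof.
move=> oU Cf Cg.
apply: eq_Ck (CkD oU Cf (CkM oU (Ck_cst k U (- 1 : R)) Cg)) => //.
by move=> x _; rewrite mulN1r.
Qed.

Lemma Ck_disc (R : realType) (V W : normedModType R) k (U : set V)
    (G : V -> W * 'M[R]_2) :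
  open U -> Ck k U G -> Ck k U (fun u => disc (G u).2).
Proof.
move=> oU CG; have e i j := Ck_snd_entry i j oU CG.
rewrite /disc; under eq_fun do rewrite expr2.
apply: CkD => //; first by apply: CkM => //; exact: CkB.
by apply: CkM => //; [exact: Ck_cst|exact: CkM].
Qed.

Section line.
Variables (R : realType) (W : normedModType R) (p w : W).

Lemma differentiable_line (t : R) : differentiable (fun t : R => p + t *: w) t.
Proof. by apply: differentiableD => //; have [] := is_diff_scalel t w. Qed.

Lemma derive_line (v t : R) : 'D_v (fun t : R => p + t *: w) t = v *: w.
Proof.
have [dl dlE] := is_diff_scalel t w.
rewrite deriveD; [|exact: derivable_cst|exact: diff_derivable].
by rewrite derive_cst add0r deriveE// dlE.
Qed.

(** The derivative is constant, so a case split on [k] replaces induction. *)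
Lemma Ck_line k : Ck k [set: R] (fun t : R => p + t *: w).
Proof.
case: k => [|k].
  by move=> t _; apply: differentiable_continuous; exact: differentiable_line.
split=> [t _|v]; first exact: differentiable_line.
rewrite (_ : (fun t => _) = fun=> v *: w); first exact: Ck_cst.
by apply/funext => t; rewrite derive_line.
Qed.

End line.

Lemma derive1_linear_comp (R : realType) (W W' : normedModType R)
    (L : {linear W -> W'}) (f : R -> W) (t : R) :
  continuous L -> differentiable f t -> derive1 (L \o f) t = L (derive1 f t).
Proof.
move=> cL df; have dL : differentiable L (f t) by exact: linear_differentiable.
rewrite !derive1E' //; last exact: differentiable_comp.
by rewrite diff_comp//= diff_lin.
Qed.

Definition traceless (R : realType) (m : 'M[R]_2) : 'M[R]_2 :=
  m - (2^-1 * \tr m)%:M.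

Lemma tracelessE (R : realType) (m : 'M[R]_2) i j :
  traceless m i j = m i j - 2^-1 * (m 0 0 + m 1 1) * (i == j)%:R.
Proof. by rewrite !mxE mxtrace2 mulr_natr. Qed.

Lemma disc_traceless (R : realType) (m : 'M[R]_2) : disc (traceless m) = disc m.
Proof. by rewrite /disc !mxE /= !mulr1n !mulr0n; ring. Qed.

Section symbol_matrix.
Variables (R : realType) (X : topologicalType) (M : manifold R 2 X).
Variables (F : vbundle M 2) (h : fibre_metric F) (sigma : symbol h).

Definition symbol_mx (k : frame_idx F) (xi : cotangent M) : 'M[R]_2 :=
  frame_mx (frame k xi.1) (sigma xi.1 xi.2).

Variables (k : frame_idx F) (xi : cotangent M).
Hypothesis xik : frame_dom k xi.1.

Let basis_k := frame_basis xik.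
Let inner_h := fib_metric_inner h xi.1.
Let sym_sigma : forall u v : fib F xi.1,
    h xi.1 (sigma xi.1 xi.2 u) v = h xi.1 u (sigma xi.1 xi.2 v) :=
  @symb_sym _ _ _ _ _ _ _ sigma xi.1 xi.2.

Lemma symbol_disc_ge0 : 0 <= disc (symbol_mx k xi).
Proof. exact (sym_disc_ge0 inner_h basis_k sym_sigma). Qed.

(** The sign is written as a factor [- 1] so that both eigenvalues fit one formula with a parameter
    [s]. *)
Lemma lambda1E :
  lambda1 sigma xi =
    (\tr (symbol_mx k xi) + (- 1) * Num.sqrt (disc (symbol_mx k xi))) / 2.
Proof.
by rewrite mulN1r; exact (inf_leigenvalue inner_h basis_k sym_sigma).
Qed.

Lemma lambda2E :
  lambda2 sigma xi =
    (\tr (symbol_mx k xi) + 1 * Num.sqrt (disc (symbol_mx k xi))) / 2.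
Proof. by rewrite mul1r; exact (sup_leigenvalue inner_h basis_k sym_sigma). Qed.

Lemma eq_lambda :
  lambda1 sigma xi = lambda2 sigma xi <-> disc (symbol_mx k xi) = 0.
Proof.
rewrite lambda1E lambda2E; split => [E|->]; last by rewrite sqrtr0 !mulr0.
have s0 : Num.sqrt (disc (symbol_mx k xi)) = 0 by lra.
by rewrite -(sqr_sqrtr symbol_disc_ge0) s0 expr0n.
Qed.

Lemma traceless_part_mx :
  frame_mx (frame k xi.1) (endo_at (traceless_part sigma xi)) =
  traceless (symbol_mx k xi).
Proof.
rewrite /traceless_part /endo_at/= (lfun_trace_frame _ basis_k).
rewrite addrC -scaleNr frame_mx_linear (frame_mx1 basis_k).
by rewrite scaleNr addrC scalemx1.
Qed.

Lemma traceless_part_eq0 :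
  disc (symbol_mx k xi) = 0 -> endo_at (traceless_part sigma xi) = 0.
Proof.
move=> d0; apply: (frame_mx_eq0 basis_k); rewrite traceless_part_mx.
rewrite /traceless {1}/symbol_mx (sym_disc_eq0 inner_h basis_k sym_sigma)//.
exact: subrr.
Qed.

(** Extracts from [symb_smooth] a smooth representative of the matrix of sigma in the coordinates of
    T*X, on a set small enough for the frame [k] to stay defined. *)
Lemma symbol_mx_lift (i : chart_idx M) : chart_dom M i xi.1 ->
  exists (U : set ('rV[R]_2 * 'cV[R]_2)%type)
    (G : 'rV[R]_2 * 'cV[R]_2 -> 'rV[R]_2 * 'M[R]_2),
    [/\ open U, U (chart_map (cotangent_charts M) i xi), Cinfty U G &
      forall y, chart_dom M i y.1 -> U (chart_map (cotangent_charts M) i y) ->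
        frame_dom k y.1 /\
        symbol_mx k y = (G (chart_map (cotangent_charts M) i y)).2].
Proof.
move=> xii.
have [U [G [oU Uxi CG UG]]] :=
  @symb_smooth _ _ _ _ _ _ _ sigma xi i (i, k) xii (conj xii xik).
exists U, G; split => // y yi Uy; have [[_ yk] E] := UG y yi Uy.
by split=> //; rewrite -E.
Qed.

End symbol_matrix.

(** * Smoothness off the multiplicity set *)

Section regular_points.
Variables (R : realType) (X : topologicalType) (M : manifold R 2 X).
Variables (F : vbundle M 2) (h : fibre_metric F) (sigma : symbol h).
(* lambda_1 is the case s = -1, lambda_2 the case s = 1. *)
Variables (lam : cotangent M -> R) (s : R).
Hypothesis lamE : forall (k : frame_idx F) xi, frame_dom k xi.1 ->
  lam xi = (\tr (symbol_mx sigma k xi) +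
            s * Num.sqrt (disc (symbol_mx sigma k xi))) / 2.

Lemma smooth_at_disc_neq0 (A : set (cotangent M)) (k : frame_idx F) xi :
  frame_dom k xi.1 -> disc (symbol_mx sigma k xi) != 0 ->
  smooth_at (cotangent_charts M) A lam xi.
Proof.
move=> xik d0 i xii.
have [U [G [oU Uxi CG UG]]] := symbol_mx_lift sigma xik xii.
(* [Ck_sqrt] needs a positive argument; continuity of [d] keeps the smaller set open, and it
   contains the point because [disc] is nonnegative on symbols and nonzero there. *)
pose d u := disc (G u).2; pose U' := U `&` [set u | 0 < d u].
have Cd l : Ck l U d by exact: Ck_disc.
have oU' : open U'.
  rewrite openE => u [Uu du]; apply: filterI; first exact: open_nbhs_nbhs.
  by have := Cd 0%N u Uu => /cvgr_gt; apply.
have CU' (W : normedModType R) l (f : _ -> W) : Ck l U f -> Ck l U' f.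
  by apply: Ck_subset; exact: subIsetl.
exists U', (fun u => (\tr (G u).2 + s * Num.sqrt (d u)) * 2^-1); split => //.
- split=> //=; have [_ E] := UG xi xii Uxi.
  by rewrite /d -E lt_neqAle eq_sym d0 symbol_disc_ge0.
- move=> l; apply: CkM => //; last exact: Ck_cst.
  apply: CkD => //.
    under eq_fun do rewrite mxtrace2.
    by apply: CU'; apply: CkD => //; exact: Ck_snd_entry.
  apply: CkM => //; first exact: Ck_cst.
  have [] // := @Ck_sqrt _ _ l U' d oU'; first by move=> u [].
  exact: CU'.
- move=> y _ yi [Uy _]; have [yk E] := UG y yi Uy.
  by rewrite (lamE yk) /d E.
Qed.

End regular_points.

(** * Points of multiplicity *)

Section singular_points.
Variables (R : realType) (X : topologicalType) (M : manifold R 2 X).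
Variables (F : vbundle M 2) (h : fibre_metric F) (sigma : symbol h).
Variables (lam : cotangent M -> R) (s : R).
Hypothesis s_neq0 : s != 0.
Hypothesis lamE : forall (k : frame_idx F) xi, frame_dom k xi.1 ->
  lam xi = (\tr (symbol_mx sigma k xi) +
            s * Num.sqrt (disc (symbol_mx sigma k xi))) / 2.

Lemma endo_chart_scale (x : X) (B : 'End(fib F x)) i k :
  chart_map (endo_charts F) (i, k) \o
    (fun t : R => Tagged (fun x => 'End(fib F x)) (t *: B)) =
  fun t => (chart_map M i x, 0) + t *: (0, frame_mx (frame k x) B).
Proof.
apply/funext => t /=; congr (_, _) => /=; first by rewrite scaler0 addr0.
rewrite add0r; apply/matrixP => u v.
by rewrite !mxE /endo_at/= scale_lfunE linearZ.
Qed.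

(** The curve is a line in one fibre, which is a linear space, and stays a line in every chart. The
    base point [e] is a variable with an equation because it will be a value of
    [traceless_part sigma], only provably equal to the zero element. *)
Lemma smooth_curve_scale (x : X) (B : 'End(fib F x)) (e : endo F) :
  (forall u v, h x (B u) v = h x u (B v)) -> lfun_trace B = 0 ->
  e = Tagged (fun x => 'End(fib F x)) (0 : 'End(fib F x)) ->
  smooth_curve_in (endo_charts F) (sym0_endo h) e
    (fun t : R => Tagged (fun x => 'End(fib F x)) (t *: B)).
Proof.
move=> Bsym Btr ->; split.
- by rewrite scale0r.
- exists setT; split => //; first exact: openT.
  move=> t _; split => [u v|].
    have hx := fib_metric_inner h x.
    rewrite /= !scale_lfunE (inner_productZl hx) [RHS](inner_productC hx).
    by rewrite (inner_productZl hx) Bsym [in RHS](inner_productC hx).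
  by rewrite [LHS]lfun_traceZ Btr mulr0.
move=> [i k] /= [xi xk]; exists setT; split => //; first exact: openT.
by move=> l; rewrite endo_chart_scale; exact: Ck_line.
Qed.

Lemma not_smooth_at_disc_eq0 (A : set (cotangent M)) (k : frame_idx F) xi :
  transversal_map (cotangent_charts M) A (endo_charts F) (sym0_endo h)
    (zero_section F) (traceless_part sigma) ->
  A xi -> frame_dom k xi.1 -> disc (symbol_mx sigma k xi) = 0 ->
  ~ smooth_at (cotangent_charts M) A lam xi.
Proof.
move=> transv Axi xik d0 sm.
set i := chart_at M xi.1; have xii : chart_dom M i xi.1 by exact: mem_chart_at.
have [U [G [oU Uxi CG UG]]] := symbol_mx_lift sigma xik xii.
have [Ug [g [oUg Ugxi Cg gE]]] := sm i xii.
have [B [Bsym Btr dB]] :=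
  exists_traceless_sym (fib_metric_inner h xi.1) (frame_basis xik).
have f0 := traceless_part_eq0 xik d0.
have fxiE : traceless_part sigma xi =
    Tagged (fun x => 'End(fib F x)) (0 : 'End(fib F xi.1)).
  by rewrite -f0.
have cN := smooth_curve_scale Bsym Btr fxiE.
(* Transversality splits the velocity of the line [t *: B] into that of the traceless symbol along a
   curve [a] in [A] and that of a curve [b] in the zero section. *)
have [a [b [[a0 [Ua [oUa Ua0 UaA]] aC] [b0 [Ub [oUb Ub0 UbZ]] bC] vel]]] :=
  transv xi Axi f0 (i, k) (conj xii xik) _ cN.
have [Ua' [oUa' Ua'0 Ua'i Cphi]] := aC i xii.
have [Ub' [oUb' Ub'0 _ Cb]] := bC (i, k) (conj xii xik).
set phi := chart_map (cotangent_charts M) i \o a in Cphi.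
have dphi : differentiable phi 0 by have [+ _] := Cphi 1%N; apply.
have phi0 : phi 0 = chart_map (cotangent_charts M) i xi by rewrite /phi /= a0.
have cphi : {for 0, continuous phi} by exact: differentiable_continuous.
(* For small [t] the representatives [G] of sigma and [g] of [lam] are both valid along [a]. *)
have near_a : \forall t \near 0,
    [/\ A (a t), chart_dom M i (a t).1, U (phi t) & Ug (phi t)].
  have nU : \forall t \near 0, U (phi t).
    by apply: cphi; rewrite phi0; exact: open_nbhs_nbhs.
  have nUg : \forall t \near 0, Ug (phi t).
    by apply: cphi; rewrite phi0; exact: open_nbhs_nbhs.
  have nUa := open_nbhs_nbhs (conj oUa Ua0).
  have nUa' := open_nbhs_nbhs (conj oUa' Ua'0).
  near=> t; split; [apply: UaA|apply: Ua'i| |]; near: t => //.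
have near_k : \forall t \near 0,
    frame_dom k (a t).1 /\ symbol_mx sigma k (a t) = (G (phi t)).2.
  by apply: filterS near_a => t [_ ti Ut _]; exact: UG.
pose m t := symbol_mx sigma k (a t).
pose P t := traceless (m t).
have dm u v : differentiable (fun t => m t u v : R^o) 0.
  apply: (@near_eq_differentiable _ _ _ (fun t => (G (phi t)).2 u v : R^o)).
    by apply: filterS near_k => t [_ <-].
  have [dG _] := Ck_snd_entry u v oU (CG 1%N).
  by apply: (differentiable_comp dphi (dG _ _)); rewrite phi0.
have dP u v : differentiable (fun t => P t u v : R^o) 0.
  rewrite (_ : (fun t => _) =
    (fun t => m t u v - 2^-1 * (m t 0 0 + m t 1 1) * (u == v)%:R)).
    apply: differentiableB; first exact: dm.
    apply: differentiableM; last exact: differentiable_cst.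
    apply: differentiableM; first exact: differentiable_cst.
    by apply: differentiableD; exact: dm.
  by apply/funext => t; rewrite /P tracelessE.
have velc u v : snd_entry u v (velocity (C := endo_charts F) (i, k)
    (fun t : R => Tagged (fun x => 'End(fib F x)) (t *: B))) =
    frame_mx (frame k xi.1) B u v.
  by rewrite /velocity endo_chart_scale derive1E derive_line scale1r.
(* The matrix component of [b] vanishes identically near 0, so [b] contributes only base
   directions. *)
have velb u v : snd_entry u v (velocity (C := endo_charts F) (i, k) b) = 0.
  rewrite /velocity -derive1_linear_comp; last 2 first.
  - exact: snd_entry_continuous.
  - by have [+ _] := Cb 1%N; apply.
  rewrite derive1E (@near_eq_derive _ _ _ _ (cst 0)) ?derive_cst//.
  apply: filterS (open_nbhs_nbhs (conj oUb Ub0)) => t /UbZ bt0.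
  by rewrite /= /snd_entry /= mxE bt0 zero_lfunE linear0.
(* The chart of the traceless symbol along [a] has matrix component [P t] near 0, where the frame
   [k] is defined. With [velb] and [velc], the matrix part of [vel] then says that the derivative of
   [P] at 0 is [B]. *)
have velf u v : snd_entry u v (velocity (C := endo_charts F) (i, k)
    (traceless_part sigma \o a)) = derive1 (fun t => P t u v) 0.
  have near_f : \forall t \near 0, ((phi t).1, P t) =
      chart_map (endo_charts F) (i, k) (traceless_part sigma (a t)).
    apply: filterS near_k => t [tk _].
    by rewrite /P -traceless_part_mx.
  rewrite /velocity -derive1_linear_comp; last 2 first.
  - exact: snd_entry_continuous.
  - apply: near_eq_differentiable near_f _.
    apply: differentiable_pair.
      apply: (differentiable_comp dphi).
      apply: (@linear_differentiable _ _ _ fst).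
      by move=> w; exact: cvg_fst.
    apply/derivable1_diffP/derivable_mxP => u' v'; exact: diff_derivable.
  rewrite !derive1E; apply: near_eq_derive.
  by apply: filterS near_f => t; rewrite /= => <-.
have := @sqrt_disc_not_derivable R P (frame_mx (frame k xi.1) B); apply => //.
- rewrite /P /m a0 -(traceless_part_mx sigma xik) f0.
  by apply/matrixP => u v; rewrite !mxE zero_lfunE linear0.
- move=> u v; apply: DeriveDef; first exact: diff_derivable.
  rewrite -derive1E -velf -velc vel.
  by rewrite linearD /= velb addr0.
- apply: filterS near_k => t [tk _]; rewrite disc_traceless.
  exact: symbol_disc_ge0.
have dlam : differentiable (fun t => g (phi t)) 0.
  have [dg _] := Cg 1%N.
  by apply: (differentiable_comp dphi (dg _ _)); rewrite phi0.
(* Solving [lamE] for the root gives [(2 * lam - tr) / s]; along [a], which stays in [A], [lam] may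
   be replaced by its smooth extension [g]. Thus the root would be differentiable at 0. *)
have dsq : differentiable
    (fun t => (2 * g (phi t) - (m t 0 0 + m t 1 1)) * s^-1) 0.
  apply: differentiableM; last exact: differentiable_cst.
  apply: differentiableB; last by apply: differentiableD; exact: dm.
  by apply: differentiableM => //; exact: differentiable_cst.
apply: diff_derivable; apply: near_eq_differentiable dsq.
apply: filterS2 near_a near_k => t [At ti _ Ugt] [tk _].
rewrite disc_traceless -(gE (a t) At ti Ugt) (lamE tk) mxtrace2 /m; field.
exact: s_neq0.
Unshelve. all: by end_near. Qed.

End singular_points.

Theorem proposition3 (R : realType) (X : topologicalType) (M : manifold R 2 X)
    (X_compact : compact [set: X]) (X_connected : connected [set: X])
    (X_oriented : oriented_manifold M) (g : riemannian_metric M)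
    (F : vbundle M 2) (F_oriented : oriented_vbundle F) (h : fibre_metric F)
    (sigma : symbol h)
    (sigma0_transversal :
       transversal_map (cotangent_charts M) (unit_cosphere g)
         (endo_charts F) (sym0_endo h) (zero_section F)
         (traceless_part sigma)) :
  multiplicity_set sigma g =
    sing (cotangent_charts M) (unit_cosphere g) (lambda1 sigma) /\
  sing (cotangent_charts M) (unit_cosphere g) (lambda1 sigma) =
    sing (cotangent_charts M) (unit_cosphere g) (lambda2 sigma).
Proof.
(* Both eigenvalues are treated at once; each singular set is compared with the multiplicity set,
   and the equality between the two singular sets follows through it. *)
have key lam s : s != 0 ->
    (forall (k : frame_idx F) xi, frame_dom k xi.1 -> lam xi =
      (\tr (symbol_mx sigma k xi) +
       s * Num.sqrt (disc (symbol_mx sigma k xi))) / 2) ->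
    multiplicity_set sigma g = sing (cotangent_charts M) (unit_cosphere g) lam.
  move=> s0 lamE; apply/seteqP; split => xi [uxi].
    move=> eq_lam; have [k xik] := frame_cover F xi.1.
    have d0 := (eq_lambda sigma xik).1 eq_lam.
    split => //.
    exact: (not_smooth_at_disc_eq0 s0 lamE sigma0_transversal uxi xik d0).
  move=> nsm; have [k xik] := frame_cover F xi.1.
  split => //; apply/(eq_lambda sigma xik); apply/eqP.
  apply: contra_notT nsm => d0.
  exact: (smooth_at_disc_neq0 lamE _ xik d0).
have key1 := key _ (- 1) _ (fun k xi => @lambda1E _ _ _ _ _ sigma k xi).
have key2 := key _ 1 _ (fun k xi => @lambda2E _ _ _ _ _ sigma k xi).
by rewrite -key1 ?oppr_eq0 ?oner_eq0// -key2 ?oner_eq0.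
Qed.
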